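(* Let $T$ be a locally finite infinite tree rooted at $\rho$ with branching factor $b>1$, and let $0<\lambda<\lambda_c(b)=\frac{b^b}{(b-1)^{b+1}}$. Then the hard core model with vertex activity $\lambda$ exhibits uniqueness of Gibbs measure on $T$.
   Context: A cutset $C$ in $T$ is a set of vertices such that every infinite path starting at $\rho$ passes through $C$ and no vertex of $C$ is an ancestor of another. $|v|$ is the distance from $\rho$ to $v$; $T_{\le C}$ is $T$ with all descendants of vertices of $C$ removed, and $T_{<C}$ is $T_{\le C}$ with $C$ removed. For boundary conditions $\sigma,\tau$ fixing the (occupied/unoccupied, consistent with independence) state of all vertices of $C$ but of no vertex of $T_{<C}$, let $R_\rho(\sigma,T)$ be the occupation ratio $p/(1-p)$ at $\rho$, where $p$ is the probability that $\rho$ is occupied in the hard core model (independent set $I$ weighted $\lambda^{|I|}$) on $T_{\le C}$ conditioned on $\sigma$. The discrepancy $\delta(C)$ is the maximum over such $\sigma,\tau$ of $R_\rho(\sigma,T)-R_\rho(\tau,T)$. The model exhibits uniqueness of Gibbs measure on $T$ if there is a sequence of cutsets $(B_i)$ with $\mathrm{dist}(\rho,B_i)\to\infty$ and $\delta(B_i)\to0$. The branching factor is $\mathrm{br}(T)=\inf\{\beta>0:\inf_C\sum_{v\in C}\beta^{-|v|}=0\}$, the inner infimum over all cutsets $C$. *)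

(* Defs.v *)
From mathcomp Require Import all_boot all_order all_algebra finmap.
From mathcomp Require Import all_classical all_reals all_analysis.
Set Implicit Arguments.
Unset Strict Implicit.
Unset Printing Implicit Defensive.
Import Order.TTheory GRing.Theory Num.Theory.
Import numFieldNormedType.Exports.
Local Open Scope classical_set_scope.
Local Open Scope ring_scope.

(* A rooted tree is given by its parent map: the root is the only vertex
   without a parent (by convention it is mapped to itself), and every vertex
   reaches the root by taking parents, which gives connectedness and the
   absence of cycles. *)
Record rootedTree := RootedTree {
  vertex :> choiceType;
  root : vertex;
  parent : vertex -> vertex;
  parent_root : parent root = root;
  parent_reach : forall v, exists n, iter n parent v == root
}.

Arguments root {T} : rename.
Arguments parent {T} : rename.

Section Tree.
Variable T : rootedTree.
Implicit Types (u v : T) (C : set T).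

Definition adj u v : bool := (u != v) && ((parent u == v) || (parent v == u)).

Definition locally_finite : Prop := forall v, finite_set [set w | adj v w].

Definition depth v : nat := ex_minn (parent_reach v).

Definition ancestor u v : Prop := u <> v /\ exists n, iter n parent v = u.

Definition infinite_path (p : nat -> T) : Prop :=
  [/\ p 0%N = root, injective p & forall n, adj (p n) (p n.+1)].

Definition cutset C : Prop :=
  (forall p, infinite_path p -> exists n, C (p n)) /\
  (forall u v, C u -> C v -> ~ ancestor u v).

(* The vertex set of T_{<= C}. *)
Definition upto C : set T := [set v | forall u, C u -> ~ ancestor u v].

Definition independent (A : set T) : Prop :=
  forall u v, A u -> A v -> ~~ adj u v.

(* The set of occupied vertices of C represents the boundary condition. *)
Definition boundary_condition C (sigma : set T) : Prop :=
  sigma `<=` C /\ independent sigma.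

End Tree.

Section Model.
Variables (R : realType) (T : rootedTree).
Implicit Types (C sigma tau : set T) (lam beta : R).

Definition branching_factor : \bar R :=
  ereal_inf [set beta%:E | beta in [set beta : R | 0 < beta /\
    ereal_inf [set \esum_(v in C) (beta ^- depth v)%:E | C in @cutset T]
      = 0%E]].

(* In a locally finite tree upto C is finite for every cutset C (Koenig), so
   the sums below range over finitely many sets I. *)
Definition independent_sets C : set {fset T} :=
  [set I | [set` I] `<=` upto C /\ independent [set` I]].

Definition hc_weight lam C (E : set {fset T}) : R :=
  \sum_(I \in independent_sets C `&` E) lam ^+ #|` I|.

Definition hc_prob lam C (E : set {fset T}) : R :=
  hc_weight lam C E / hc_weight lam C setT.

Definition hc_cond_prob lam C (E F : set {fset T}) : R :=
  hc_prob lam C (E `&` F) / hc_prob lam C F.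

Definition agrees C sigma : set {fset T} := [set I | [set` I] `&` C = sigma].

Definition root_prob lam C sigma : R :=
  hc_cond_prob lam C [set I | root \in I] (agrees C sigma).

(* Division in \bar R: the ratio is +oo when the root is occupied with
   probability 1, which only happens for C = [set root]. *)
Definition root_ratio lam C sigma : \bar R :=
  let p := root_prob lam C sigma in (p%:E / (1 - p)%:E)%E.

(* There are finitely many boundary conditions, so the supremum is a maximum. *)
Definition discrepancy lam C : \bar R :=
  ereal_sup [set d : \bar R | exists sigma tau,
    [/\ boundary_condition C sigma, boundary_condition C tau &
        d = (root_ratio lam C sigma - root_ratio lam C tau)%E]].

Definition root_dist C : \bar R := ereal_inf [set ((depth v)%:R)%:E | v in C].

Definition gibbs_uniqueness lam : Prop :=
  exists B : nat -> set T,
    [/\ forall i, cutset (B i),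
        root_dist (B i) @[i --> \oo] --> +oo%E &
        discrepancy lam (B i) @[i --> \oo] --> 0%E].

End Model.

Definition lambda_c (R : realType) (b : R) : R :=
  b `^ b / (b - 1) `^ (b + 1).

(* Main.v *)
(* The occupation ratios satisfy R_v = lam * \prod_c 1 / (1 + R_c) over the children c
   of v.  Measured in the potential arsinh (sqrt R), one step of this recursion
   contracts: if delta_v is the difference of the potentials for two boundary
   conditions, then |delta_v|^q <= (1/b') * \sum_c |delta_c|^q whenever
   lam <= lambda_c(b').  This comes from the mean value theorem and Hoelder's
   inequality, whose exponents are tuned so that the resulting bound is attained at
   the fixed point of the critical recursion (R = 1/(b'-1), with b' children); it holds
   whatever the number of children is.  Iterating from a cutset C up to the root gives
   |delta_root|^q <= M * \sum_(v in C) b'^-|v|.  By continuity of lambda_c we may take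
   b' > b, and then this sum can be made arbitrarily small by definition of the branching
   factor; its smallness also pushes C away from the root. *)
Require Import Defs.
From mathcomp Require Import all_boot all_order all_algebra finmap.
From mathcomp Require Import all_classical all_reals all_analysis.
Import Order.TTheory GRing.Theory Num.Theory.
Import numFieldNormedType.Exports.
From mathcomp Require Import lra.
(* Imported again so that [root] is the root of a tree and not [poly.root]. *)
Import Defs.
Local Open Scope classical_set_scope.
Local Open Scope ring_scope.

(** * The one-step contraction *)

Section Scalar.
Variable R : realType.
Implicit Types (b m t L lam x y : R).

(** Induction on the list: two-term Hoelder for the head and the norms of the tail. *)
Lemma hoelder_seq (I : Type) (s : seq I) (f g : I -> R) (p q : R) :
    (forall i, 0 <= f i) -> (forall i, 0 <= g i) ->
    0 < p -> 0 < q -> p^-1 + q^-1 = 1 ->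
  \sum_(i <- s) f i * g i <=
    (\sum_(i <- s) f i `^ p) `^ p^-1 * (\sum_(i <- s) g i `^ q) `^ q^-1.
Proof.
move=> f0 g0 p0 q0 pq; elim: s => [|i s IH].
  by rewrite !big_nil mulr_ge0 ?powR_ge0.
have sum0 r (h : I -> R) : 0 <= \sum_(j <- s) h j `^ r.
  by apply: sumr_ge0 => j _; exact: powR_ge0.
have rootK r (h : I -> R) : 0 < r ->
    ((\sum_(j <- s) h j `^ r) `^ r^-1) `^ r = \sum_(j <- s) h j `^ r.
  by move=> r0; rewrite -powRrM mulVf ?gt_eqF // powRr1.
have := hoelder2 (f0 i) (powR_ge0 (\sum_(j <- s) f j `^ p) p^-1)
  (g0 i) (powR_ge0 (\sum_(j <- s) g j `^ q) q^-1) p0 q0 pq.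
rewrite (rootK p f p0) (rootK q g q0) => H.
by rewrite !big_cons; apply: le_trans H; rewrite lerD2l.
Qed.

Lemma is_derive_ln_comp (g : R -> R) x dg : is_derive x 1 g dg -> 0 < g x ->
  is_derive x 1 (fun x => ln (g x)) ((g x)^-1 * dg).
Proof. by move=> dgP gx0; apply: is_derive1_comp; exact: is_derive1_ln. Qed.

Lemma is_derive_expR_comp (g : R -> R) x dg :
  is_derive x 1 g dg -> is_derive x 1 (fun x => expR (g x)) (expR (g x) * dg).
Proof. exact: is_derive1_comp. Qed.

(** By convexity the chord slope [(expR x - 1) / x] increases: [expR x * (1 - x) <= 1] compares it
    with the tangent slope at [x], and the tangent bounds [expR y] from below. *)
Lemma expR_chord x y : 0 < x -> x <= y -> (expR x - 1) * y <= x * (expR y - 1).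
Proof.
move=> x0 xy; have ex := expR_gt0 x.
have h1 : expR x * (1 - x) <= 1.
  have e : expR x * expR (- x) = 1 by rewrite -expRD subrr expR0.
  by rewrite -[leRHS]e ler_pM2l //; exact: expR_ge1Dx.
have h2 : expR x * (1 + (y - x)) <= expR y.
  have -> : expR y = expR x * expR (y - x) by rewrite -expRD; congr expR; lra.
  by rewrite ler_pM2l //; exact: expR_ge1Dx.
have h3 : (y - x) * (expR x * (1 - x)) <= (y - x) * 1.
  by rewrite ler_wpM2l // subr_ge0.
have h4 : x * (expR x * (1 + (y - x))) <= x * expR y by rewrite ler_wpM2l // ltW.
nra.
Qed.

(** * Critical constants and scalar estimates *)

Definition crit_dist b : R := ln (b / (b - 1)).
Definition crit_pow b : R := ((b - 1) * crit_dist b)^-1.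

(** This value is [1 + R] at the critical fixed point [R = 1 / (b - 1)], so [crit_dist b] is
    [ln (1 + R)] there. *)
Lemma expR_crit_dist b : 1 < b -> expR (crit_dist b) = b / (b - 1).
Proof. by move=> b1; rewrite lnK // posrE divr_gt0 ?subr_gt0 //; lra. Qed.

Lemma crit_dist_gt0 b : 1 < b -> 0 < crit_dist b.
Proof.
move=> b1; rewrite ln_gt0 // ltr_pdivlMr ?subr_gt0 //; lra.
Qed.

Lemma crit_pow_gt0 b : 1 < b -> 0 < crit_pow b.
Proof. by move=> b1; rewrite invr_gt0 mulr_gt0 ?subr_gt0 ?crit_dist_gt0. Qed.

(** Makes the Hoelder exponent [2 * crit_pow b] exceed 1, so that its conjugate is positive. *)
Lemma crit_pow_ge1 b : 1 < b -> 1 <= crit_pow b.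
Proof.
move=> b1; rewrite invf_ge1 ?mulr_gt0 ?subr_gt0 ?crit_dist_gt0 //.
have b0 : 0 < b - 1 by rewrite subr_gt0.
have := expR_ge1Dx (crit_dist b); rewrite expR_crit_dist // ler_pdivlMr //.
nra.
Qed.

Lemma crit_powE b : 1 < b -> crit_pow b * crit_dist b = (b - 1)^-1.
Proof.
move=> b1; have h := crit_dist_gt0 _ b1.
by rewrite /crit_pow invfM -mulrA mulVf ?mulr1 // gt_eqF.
Qed.

(* [crit_pow b] is the exponent [m] for which [(1 - e^-t)^m / t] is maximal at
   [t = crit_dist b], where [1 - e^-t = 1 / b]. *)
Lemma powR_1subexp_le b t : 1 < b -> 0 <= t ->
  (1 - expR (- t)) `^ crit_pow b <= b `^ (- crit_pow b) / crit_dist b * t.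
Proof.
move=> b1; have t0gt := crit_dist_gt0 _ b1; have mgt := crit_pow_gt0 _ b1.
have b0 : 0 < b - 1 by rewrite subr_gt0.
have bp : 0 < b by lra.
set m := crit_pow b in mgt *; set t0 := crit_dist b in t0gt *.
rewrite le_eqVlt => /orP[/eqP <-|t_gt0].
  by rewrite oppr0 expR0 subrr mulr0 powR0 // gt_eqF.
have s_gt0 x : 0 < x -> 0 < 1 - expR (- x).
  by move=> x0; rewrite subr_gt0 expR_lt1 oppr_lt0.
(* In logarithms the claim is [h t0 <= h t]; [h] decreases up to [t0] and increases afterwards. *)
pose h x := ln x - m * ln (1 - expR (- x)).
pose dh x := x^-1 - m * (expR x - 1)^-1.
have dhP x : 0 < x -> is_derive x 1 h (dh x).
  move=> x0; have d1 := is_derive1_ln x0.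
  have d3 : is_derive x (1 : R) (fun x => 1 - expR (- x)) (expR (- x)).
    have d4 : is_derive x (1 : R) (fun x => expR (- x)) (expR (- x) * -1).
      exact: is_derive_expR_comp.
    by apply: is_derive_eq; lra.
  have d4 := is_derive_ln_comp _ _ _ d3 (s_gt0 _ x0).
  rewrite /h; apply: is_derive_eq.
  rewrite /dh; congr (_ - _ * _).
  rewrite -[X in _ * X]invrK -invfM -expRN opprK; congr (_^-1).
  by rewrite mulrBl mul1r -expRD addNr expR0.
have chx x : 0 < x -> dh x = (expR x - 1 - m * x) / (x * (expR x - 1)).
  move=> x0; have ex : 0 < expR x - 1 by rewrite subr_gt0 expR_gt1.
  have hx : x * x^-1 = 1 by rewrite mulfV ?gt_eqF.
  have hy : (expR x - 1) * (expR x - 1)^-1 = 1 by rewrite mulfV ?gt_eqF.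
  rewrite /dh invfM mulrBl mulrCA hy mulr1 -(mulrA m) (mulrA x) hx mul1r //.
(* [t0] is a zero of the numerator of [dh]; this equation dictates the value of [crit_pow b]. *)
have E0 : expR t0 - 1 = m * t0.
  rewrite expR_crit_dist // crit_powE //.
  by rewrite -[X in _ - X](mulfV (lt0r_neq0 b0)) -mulrBl opprB addrCA subrr addr0 mul1r.
have den x : 0 < x -> 0 < (x * (expR x - 1))^-1.
  by move=> x0; rewrite invr_gt0 mulr_gt0 // subr_gt0 expR_gt1.
have dh_ge0 x : t0 <= x -> 0 <= dh x.
  move=> xt; have x0 : 0 < x by lra.
  have H := expR_chord _ _ t0gt xt; rewrite chx // pmulr_lge0 ?den //.
  rewrite -(pmulr_rge0 _ t0gt); rewrite E0 in H; lra.
have dh_le0 x : 0 < x -> x <= t0 -> dh x <= 0.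
  move=> x0 xt; have H := expR_chord _ _ x0 xt; rewrite chx // pmulr_lle0 ?den //.
  rewrite -(pmulr_rle0 _ t0gt); rewrite E0 in H; lra.
have cont x : 0 < x -> {for x, continuous h}.
  move=> x0; apply: differentiable_continuous; apply/derivable1_diffP.
  exact: (@ex_derive _ _ _ _ _ _ _ (dhP _ x0)).
have key : h t0 <= h t.
  have mvt (u v : R) : 0 < u -> u <= v -> exists2 c, u <= c <= v & h v - h u = dh c * (v - u).
    move=> u0 uv; have := @MVT_segment R h dh u v uv.
    case.
    - by move=> x /[!in_itv]/= /andP[ux _]; apply: dhP; lra.
    - apply: continuous_in_subspaceT => x /[!inE]/= /[!in_itv]/= /andP[ux _].
      by apply: cont; lra.
    by move=> c /[!in_itv]/= cuv e; exists c.
  case: (leP t0 t) => tt.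
    have [c /andP[c1 c2] e] := mvt _ _ t0gt tt.
    by rewrite -subr_ge0 e; apply: mulr_ge0; [exact: dh_ge0 | rewrite subr_ge0].
  have [c /andP[c1 c2] e] := mvt _ _ t_gt0 (ltW tt).
  rewrite -subr_le0 e; apply: mulr_le0_ge0; last by rewrite subr_ge0 ltW.
  by apply: dh_le0; lra.
have s0E : 1 - expR (- t0) = b^-1.
  rewrite expRN expR_crit_dist // invf_div.
  by rewrite -[X in X - _](mulfV (lt0r_neq0 bp)) -mulrBl opprB addrCA subrr addr0 mul1r.
have st := s_gt0 _ t_gt0.
rewrite -ler_ln ?posrE ?mulr_gt0 ?divr_gt0 ?powR_gt0 //; last by rewrite invr_gt0.
rewrite ln_powR !lnM ?posrE ?mulr_gt0 ?divr_gt0 ?powR_gt0 ?invr_gt0 //.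
rewrite ln_powR lnV ?posrE //.
move: key; rewrite /h s0E lnV ?posrE //; lra.
Qed.

Lemma invr_powR x (r : R) : 0 <= x -> x^-1 `^ r = x `^ (- r).
Proof. by move=> x0; rewrite -powR_inv1 // -powRrM mulN1r. Qed.

Lemma lambda_cE b : 1 < b -> lambda_c b = expR (b * crit_dist b) / (b - 1).
Proof.
move=> b1; have b0 : 0 < b - 1 by rewrite subr_gt0.
have bp : 0 < b by lra.
have -> : expR (b * crit_dist b) = (b / (b - 1)) `^ b.
  by rewrite /powR gt_eqF // divr_gt0.
rewrite /lambda_c.
rewrite powRM ?invr_ge0 ?(ltW bp) ?(ltW b0) // invr_powR ?(ltW b0) // powRN.
rewrite [X in _ / X]powRD ?(gt_eqF b0) ?implybT // powRr1 ?(ltW b0) //.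
by rewrite invfM mulrA.
Qed.

(** With [F = lam * expR (- L)] and [u = L - b * crit_dist b], the bound on [lam] says
    [(b - 1) * expR u * F <= 1]; weighted AM-GM for 1 and [expR u] does the rest. Equality holds at
    [u = 0] when [lam = lambda_c b]. *)
Lemma occupation_le b lam L : 1 < b -> 0 < lam -> lam <= lambda_c b ->
  lam * expR (- L) / (1 + lam * expR (- L)) <=
    b^-1 * expR (- ((1 - b^-1) * (L - b * crit_dist b))).
Proof.
move=> b1 lam0; rewrite lambda_cE // => lamle.
have b0 : 0 < b - 1 by rewrite subr_gt0.
have bp : 0 < b by lra.
set L0 := b * _ in lamle *; set u := L - L0.
have eL : 0 < expR L by exact: expR_gt0.
have E : (b - 1) * expR u * (lam * expR (- L)) <= 1.
  rewrite /u expRD !expRN.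
  rewrite ler_pdivlMr // in lamle.
  have e0 : 0 < expR L0 by exact: expR_gt0.
  have -> : (b - 1) * (expR L / expR L0) * (lam / expR L) = lam * (b - 1) / expR L0.
    have h : expR L * (expR L)^-1 = 1 by rewrite mulfV ?gt_eqF.
    by rewrite -[RHS]mul1r -h; lra.
  by rewrite ler_pdivrMr // mul1r.
set F := lam * expR (- L) in E *.
have F0 : 0 < F by rewrite mulr_gt0 // expR_gt0.
(* AM-GM with weights [1 / b] and [1 - 1 / b]: divide by [expR ((1 - b^-1) * u)] and add two
   tangent-line bounds at 0. *)
have P : b * expR ((1 - b^-1) * u) <= 1 + (b - 1) * expR u.
  have h1 := expR_ge1Dx (- ((1 - b^-1) * u)); have h2 := expR_ge1Dx (u / b).
  have h : b <= expR (- ((1 - b^-1) * u)) + (b - 1) * expR (u / b).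
    have h3 : (b - 1) * (1 + u / b) <= (b - 1) * expR (u / b) by rewrite ler_pM2l.
    apply: le_trans (lerD h1 h3); rewrite le_eqVlt; apply/orP; left; apply/eqP.
    have h : b * b^-1 = 1 by rewrite mulfV ?gt_eqF.
    have h' : u * (b * b^-1) = u by rewrite h mulr1.
    lra.
  have := ler_wpM2r (expR_ge0 ((1 - b^-1) * u)) h.
  rewrite [X in _ <= X -> _]mulrDl -(mulrA (b - 1)) -!expRD.
  rewrite addNr expR0; have -> : u / b + (1 - b^-1) * u = u by lra.
  by [].
rewrite expRN -invfM ler_pdivrMr ?addr_gt0 //.
rewrite mulrC ler_pdivlMr ?mulr_gt0 ?expR_gt0 //.
rewrite (le_trans (ler_wpM2l (ltW F0) P)) //.
by rewrite mulrDr mulr1 addrC lerD2r mulrC.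
Qed.

(** Put [L0 = b * crit_dist b]. As [crit_pow b * (1 - b^-1) = L0^-1], the power of [occupation_le]
    decays like [expR (1 - L / L0)], which [L <= L0 * expR (L / L0 - 1)] cancels exactly. *)
Lemma powR_occupation_le b lam L : 1 < b -> 0 < lam -> lam <= lambda_c b ->
  0 <= L ->
  (lam * expR (- L) / (1 + lam * expR (- L))) `^ crit_pow b * L <=
    b `^ (- crit_pow b) * (b * crit_dist b).
Proof.
move=> b1 lam0 lamle L_ge0.
have b0 : 0 < b - 1 by rewrite subr_gt0.
have bp : 0 < b by lra.
have mgt := crit_pow_gt0 _ b1; have tgt := crit_dist_gt0 _ b1.
have F0 : 0 < lam * expR (- L) by rewrite mulr_gt0 // expR_gt0.
have H := occupation_le _ _ L b1 lam0 lamle.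
have {}H : (lam * expR (- L) / (1 + lam * expR (- L))) `^ crit_pow b <=
    b `^ (- crit_pow b) * expR (1 - L / (b * crit_dist b)).
  apply: le_trans (ge0_ler_powR (ltW mgt) _ _ H) _; rewrite ?nnegrE.
  - by rewrite divr_ge0 // ltW // addr_gt0.
  - by rewrite mulr_ge0 ?expR_ge0 // invr_ge0 ltW.
  rewrite powRM ?expR_ge0 ?invr_ge0 ?(ltW bp) //.
  rewrite invr_powR ?(ltW bp) // ler_wpM2l ?powR_ge0 //.
  rewrite -expRM ler_expR le_eqVlt; apply/orP; left; apply/eqP.
    have h : b * b^-1 = 1 by rewrite mulfV ?gt_eqF.
  have -> : 1 - b^-1 = b^-1 * (b - 1) by lra.
  have -> : crit_pow b = (b - 1)^-1 * (crit_dist b)^-1 by rewrite /crit_pow invfM.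
  have hc : crit_dist b * (crit_dist b)^-1 = 1 by rewrite mulfV ?gt_eqF.
  have hb : (b - 1) * (b - 1)^-1 = 1 by rewrite mulfV ?gt_eqF.
  rewrite invfM.
  transitivity (- ((b - 1) * (b - 1)^-1 * (L * b^-1 * (crit_dist b)^-1)) +
    (b - 1) * (b - 1)^-1 * (b * b^-1) * (crit_dist b * (crit_dist b)^-1)); first by lra.
  by rewrite hb h hc; lra.
have Lle : L <= b * crit_dist b * expR (L / (b * crit_dist b) - 1).
  have := expR_ge1Dx (L / (b * crit_dist b) - 1).
  rewrite addrC subrK ler_pdivrMr ?mulr_gt0 // mulrC //.
have := ler_pM (powR_ge0 _ _) L_ge0 H Lle; move/le_trans; apply.
have e : expR (1 - L / (b * crit_dist b)) * expR (L / (b * crit_dist b) - 1) = 1.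
  by rewrite -expRD -[RHS]expR0; congr expR; lra.
by rewrite mulrACA e mulr1.
Qed.

(** * The potential and hyperbolic coordinates *)

(* This is [arsinh (sqrt x)], so that [x = sinhR y ^+ 2] and [1 + x = coshR y ^+ 2]
   for [y = potential x]. *)
Definition potential x : R := ln (Num.sqrt x + Num.sqrt (1 + x)).
Definition coshR y : R := (expR y + expR (- y)) / 2.
Definition sinhR y : R := (expR y - expR (- y)) / 2.

Lemma coshR_gt0 y : 0 < coshR y.
Proof. by rewrite divr_gt0 // addr_gt0 // expR_gt0. Qed.

Lemma sinhR_ge0 y : 0 <= y -> 0 <= sinhR y.
Proof.
by move=> y0; rewrite divr_ge0 // subr_ge0 ler_expR; lra.
Qed.

Lemma coshR2 y : coshR y ^+ 2 = 1 + sinhR y ^+ 2.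
Proof.
have e : expR y * expR (- y) = 1 by rewrite -expRD subrr expR0.
rewrite /coshR /sinhR; nra.
Qed.

Lemma coshR_ge1 y : 1 <= coshR y.
Proof. by have := coshR2 y; have := coshR_gt0 y; nra. Qed.

Lemma potential_arg_ge1 x : 0 <= x -> 1 <= Num.sqrt x + Num.sqrt (1 + x).
Proof.
move=> x0; have : 1 <= Num.sqrt (1 + x) by rewrite -[leLHS]sqrtr1 ler_sqrt; lra.
by have := sqrtr_ge0 x; lra.
Qed.

Lemma potential_ge0 x : 0 <= x -> 0 <= potential x.
Proof. by move=> x0; rewrite ln_ge0 // potential_arg_ge1. Qed.

Lemma le_potential x y : 0 <= x -> x <= y -> potential x <= potential y.
Proof.
move=> x0 xy; have y0 := le_trans x0 xy.
have hx := potential_arg_ge1 _ x0; have hy := potential_arg_ge1 _ y0.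
rewrite ler_ln ?posrE; [|lra|lra].
by apply: lerD; rewrite ler_sqrt //; lra.
Qed.

Lemma expR_potential x : 0 <= x ->
  expR (potential x) = Num.sqrt x + Num.sqrt (1 + x).
Proof. by move=> /potential_arg_ge1 h; rewrite lnK // posrE; lra. Qed.

Lemma coshR_potential x : 0 <= x -> coshR (potential x) ^+ 2 = 1 + x.
Proof.
move=> x0; have x1 : 0 <= 1 + x by lra.
have h := potential_arg_ge1 _ x0.
have e : expR (- potential x) = Num.sqrt (1 + x) - Num.sqrt x.
  rewrite expRN expR_potential //.
  apply: (mulfI (lt0r_neq0 (lt_le_trans ltr01 h))).
  rewrite mulfV; last by rewrite gt_eqF //; lra.
  by have := sqr_sqrtr x0; have := sqr_sqrtr x1; nra.
have -> : coshR (potential x) = Num.sqrt (1 + x).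
  by rewrite /coshR e expR_potential //; lra.
by rewrite sqr_sqrtr.
Qed.

(** Converts bounds on potentials back to ratios: the inverse of [potential] is Lipschitz on
    [[0, lam]]. *)
Lemma sub_le_potential lam x y : 0 <= x -> 0 <= y -> x <= lam -> y <= lam ->
  x - y <= 2 * Num.sqrt lam * expR (potential lam) * `|potential x - potential y|.
Proof.
move=> x0 y0 xl yl.
have cst0 : 0 <= 2 * Num.sqrt lam * expR (potential lam).
  by rewrite mulr_ge0 ?expR_ge0 // mulr_ge0 ?sqrtr_ge0.
have [xy|yx] := leP x y.
  by apply: (@le_trans _ _ 0); [lra|rewrite mulr_ge0].
have lam0 : 0 <= lam by lra.
have pyx : potential y <= potential x by apply: le_potential => //; lra.
rewrite ger0_norm ?subr_ge0 //.
have sx := sqr_sqrtr x0; have sy := sqr_sqrtr y0.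
have s1 : Num.sqrt x <= Num.sqrt lam by rewrite ler_sqrt.
have s2 : Num.sqrt y <= Num.sqrt lam by rewrite ler_sqrt.
have s3 : Num.sqrt y <= Num.sqrt x by rewrite ler_sqrt // ltW.
have s4 : Num.sqrt (1 + y) <= Num.sqrt (1 + x) by rewrite ler_sqrt //; lra.
have s5 := sqrtr_ge0 y.
have s6 := sqrtr_ge0 x.
have e1 : Num.sqrt x - Num.sqrt y <= expR (potential lam) * (potential x - potential y).
  have h : expR (potential x) - expR (potential y) <=
      expR (potential x) * (potential x - potential y).
    have h := expR_ge1Dx (potential y - potential x).
    have := ler_wpM2l (expR_ge0 (potential x)) h.
    by rewrite -expRD (addrC (potential x)) subrK; lra.
  have h2 : expR (potential x) * (potential x - potential y) <=
      expR (potential lam) * (potential x - potential y).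
    by rewrite ler_wpM2r ?subr_ge0 // ler_expR le_potential.
  by have ex := expR_potential _ x0; have ey := expR_potential _ y0; lra.
have -> : x - y = (Num.sqrt x + Num.sqrt y) * (Num.sqrt x - Num.sqrt y) by lra.
rewrite -mulrA; apply: ler_pM => //; lra.
Qed.

(** The derivative blows up at 0, hence [0 < x]. Multiplied by [x] it is half the square root of the
    occupation probability [x / (1 + x)]. *)
Lemma is_derive_potential x : 0 < x ->
  is_derive x 1 potential (2 * Num.sqrt x * Num.sqrt (1 + x))^-1.
Proof.
move=> x0; have x1 : 0 < 1 + x by lra.
have d1 := is_derive1_sqrt x0.
have d2 : is_derive x 1 (fun x : R => Num.sqrt (1 + x)) ((2 * Num.sqrt (1 + x))^-1 * 1).
  apply: (@is_derive1_comp _ (@Num.sqrt R) (fun x : R => 1 + x)).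
    exact: is_derive1_sqrt.
  by apply: is_derive_eq; lra.
have h := potential_arg_ge1 _ (ltW x0).
have d3 : is_derive x 1 (fun x : R => Num.sqrt x + Num.sqrt (1 + x))
    ((2 * Num.sqrt x)^-1 + (2 * Num.sqrt (1 + x))^-1 * 1).
  exact: is_deriveD.
have := is_derive_ln_comp _ _ _ d3; move/(_ (lt_le_trans ltr01 h)).
move/is_derive_eq; apply.
have s0 : 0 < Num.sqrt x by rewrite sqrtr_gt0.
have s1 : 0 < Num.sqrt (1 + x) by rewrite sqrtr_gt0.
set s := Num.sqrt x in h s0 *; set t := Num.sqrt (1 + x) in h s1 *.
have st : s + t != 0 by rewrite gt_eqF //; lra.
apply: (mulfI st); rewrite mulrA mulfV // mul1r mulr1 !invfM.
have hs : s * s^-1 = 1 by rewrite mulfV ?gt_eqF.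
have ht : t * t^-1 = 1 by rewrite mulfV ?gt_eqF.
rewrite mulrDl.
have -> : s * (2^-1 / s / t) = 2^-1 * (s * s^-1) * t^-1 by lra.
have -> : t * (2^-1 / s / t) = 2^-1 * s^-1 * (t * t^-1) by lra.
by rewrite hs ht; lra.
Qed.

(** For [y = potential x] the function is [ln (1 + x)], which turns the product over the children
    into a sum. *)
Lemma is_derive_lncosh y :
  is_derive y 1 (fun y => 2 * ln (coshR y)) (2 * (sinhR y / coshR y)).
Proof.
have d1 : is_derive y (1 : R) (fun x => expR (- x)) (expR (- y) * -1).
  exact: is_derive_expR_comp.
have d2 : is_derive y 1 coshR (sinhR y).
  by rewrite /coshR; apply: is_derive_eq; rewrite /GRing.scale /= /sinhR; lra.
have d3 := is_derive_ln_comp _ _ _ d2 (coshR_gt0 y).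
by apply: is_derive_eq; rewrite /GRing.scale /=; lra.
Qed.

(** * Contraction for an arbitrary list of children *)

Lemma is_derive_sum_seq (I : Type) (s : seq I) (f : I -> R -> R) (df : I -> R) x :
  (forall i, is_derive x 1 (f i) (df i)) ->
  is_derive x 1 (fun x => \sum_(i <- s) f i x) (\sum_(i <- s) df i).
Proof.
move=> fP; elim: s => [|i s IH].
  under eq_fun do rewrite big_nil.
  by rewrite big_nil; exact: is_derive_cst.
under eq_fun do rewrite big_cons.
by rewrite big_cons; exact: is_deriveD.
Qed.

(** The Hoelder conjugate of [2 * crit_pow b]: the exponent [q] in which differences of potentials
    are measured. *)
Definition crit_conj b : R := (1 - (2 * crit_pow b)^-1)^-1.

Lemma crit_conj_gt0 b : 1 < b -> 0 < crit_conj b.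
Proof.
move=> /crit_pow_ge1 m1; rewrite invr_gt0 subr_gt0 invf_lt1; lra.
Qed.

(** The square of tanh is [1 - expR (- t)] at [t = 2 * ln (coshR y)], so [powR_1subexp_le]
    applies. *)
Lemma powR_tanh_le b y : 1 < b -> 0 <= y ->
  (sinhR y / coshR y) `^ (2 * crit_pow b) <=
    b `^ (- crit_pow b) / crit_dist b * (2 * ln (coshR y)).
Proof.
move=> b1 y0; have c0 := coshR_gt0 y; have s0 := sinhR_ge0 _ y0.
have c1 := coshR_ge1 y.
have r0 : 0 <= sinhR y / coshR y by apply: divr_ge0 => //; exact: ltW.
have := powR_1subexp_le _ (2 * ln (coshR y)) b1; move/(_ _); rewrite mulr_ge0 ?ln_ge0 //.
move/(_ isT); apply: le_trans; rewrite powRrM powR_mulrn //.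
rewrite [X in X `^ _ <= _](_ : _ = 1 - expR (- (2 * ln (coshR y)))) //.
rewrite expRN expRM_natl lnK ?posrE // exprMn exprVn.
have h : coshR y ^+ 2 * (coshR y ^+ 2)^-1 = 1 by rewrite mulfV // expf_neq0 // gt_eqF.
have -> : sinhR y ^+ 2 = coshR y ^+ 2 - 1 by rewrite coshR2; lra.
by rewrite mulrBl mul1r h.
Qed.

(* In the coordinates [y i = potential (x i)] the partial derivatives are
   [- sqrt (F / (1 + F)) * tanh (y i)] with [F = lam * expR (- S)] and
   [S = \sum_i 2 ln (cosh (y i))].  Hoelder's inequality with exponents
   [2 * crit_pow b] and [crit_conj b] and the two scalar estimates
   [powR_tanh_le] and [powR_occupation_le] leave exactly the factor [1 / b]. *)
Lemma hard_core_contraction b lam (I : Type) (s : seq I) (x x' : I -> R) :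
    1 < b -> 0 < lam -> lam <= lambda_c b ->
    (forall i, 0 <= x i) -> (forall i, 0 <= x' i) ->
  `|potential (lam * \prod_(i <- s) (1 + x i)^-1) -
    potential (lam * \prod_(i <- s) (1 + x' i)^-1)| `^ crit_conj b <=
  b^-1 * \sum_(i <- s) `|potential (x i) - potential (x' i)| `^ crit_conj b.
Proof.
move=> b1 lam0 lamle x0 x'0.
have bp : 0 < b by lra.
have m1 := crit_pow_ge1 _ b1; have q0 := crit_conj_gt0 _ b1.
have t0 := crit_dist_gt0 _ b1.
(* The segment from [x'] to [x] in potential coordinates; [F] and [G] are the ratio at the parent
   and its potential along it. *)
pose y i (t : R) := potential (x' i) + t * (potential (x i) - potential (x' i)).
pose d i := potential (x i) - potential (x' i).
pose lc (z : R) := 2 * ln (coshR z).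
pose S t := \sum_(i <- s) lc (y i t).
pose F t := lam * expR (- S t).
pose G t := potential (F t).
have lcE (z : R) : 0 <= z -> expR (- lc (potential z)) = (1 + z)^-1.
  move=> z0; rewrite expRN /lc expRM_natl lnK ?posrE ?coshR_gt0 //.
  by rewrite coshR_potential.
have FE t (z : I -> R) : (forall i, 0 <= z i) -> (forall i, y i t = potential (z i)) ->
    F t = lam * \prod_(i <- s) (1 + z i)^-1.
  move=> z0 yz; rewrite /F /S -sumrN; congr (_ * _).
  by rewrite expR_sum; apply: eq_bigr => i _; rewrite yz lcE.
have <- : G 1 = potential (lam * \prod_(i <- s) (1 + x i)^-1).
  by rewrite /G (FE 1 x) // => i; rewrite /y; lra.
have <- : G 0 = potential (lam * \prod_(i <- s) (1 + x' i)^-1).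
  by rewrite /G (FE 0 x') // => i; rewrite /y; lra.
have F0 t : 0 < F t by rewrite mulr_gt0 ?expR_gt0.
pose th i t := sinhR (y i t) / coshR (y i t).
pose dG t : R := (2 * Num.sqrt (F t) * Num.sqrt (1 + F t))^-1 *
  (F t * - \sum_(i <- s) 2 * th i t * d i).
have dGP t : is_derive t 1 G (dG t).
  apply: (@is_derive1_comp _ potential F); first exact: is_derive_potential.
  have dy i : is_derive t 1 (y i) (d i).
    by rewrite /y; apply: is_derive_eq; rewrite /GRing.scale /= /d; lra.
  have dS : is_derive t 1 S (\sum_(i <- s) 2 * th i t * d i).
    apply: is_derive_sum_seq => i; rewrite /th.
    apply: (@is_derive1_comp _ lc (y i)).
    exact: is_derive_lncosh.
  have dN : is_derive t 1 (fun t => - S t) (- \sum_(i <- s) 2 * th i t * d i).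
    exact: is_deriveN.
  have dE := is_derive_expR_comp _ _ _ dN.
  by rewrite /F; apply: is_derive_eq; rewrite /GRing.scale /=; lra.
have cG t : {for t, continuous G}.
  apply: differentiable_continuous; apply/derivable1_diffP.
  exact: (@ex_derive _ _ _ _ _ _ _ (dGP t)).
have [t] := @MVT_segment R G dG 0 1 ler01 (fun t _ => dGP t)
  (continuous_subspaceT cG).
rewrite in_itv /= subr0 mulr1 => /andP[t_ge0 t_le1] ->.
have y0 i : 0 <= y i t.
  have := potential_ge0 _ (x0 i); have := potential_ge0 _ (x'0 i).
  by rewrite /y; nra.
have th0 i : 0 <= th i t by rewrite /th divr_ge0 ?sinhR_ge0 // ltW // coshR_gt0.
set a := 2 * crit_pow b.
set q := crit_conj b in q0 *.
have a0 : 0 < a by rewrite /a; lra.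
have aq : a^-1 + q^-1 = 1 by rewrite /q /crit_conj invrK addrC subrK.
pose g : R := Num.sqrt (F t) / Num.sqrt (1 + F t).
have F1 : 0 < 1 + F t by have := F0 t; lra.
have g0 : 0 <= g by rewrite divr_ge0 ?sqrtr_ge0.
have dGle : `|dG t| <= g * \sum_(i <- s) th i t * `|d i|.
  have -> : dG t = - (g * \sum_(i <- s) th i t * d i).
    rewrite /dG.
    have -> : \sum_(i <- s) 2 * th i t * d i = 2 * \sum_(i <- s) th i t * d i.
      by rewrite mulr_sumr; apply: eq_bigr => i _; rewrite mulrA.
    rewrite /g !invfM -[X in _ * (X * - _)](sqr_sqrtr (ltW (F0 t))).
    have h : Num.sqrt (F t) * (Num.sqrt (F t))^-1 = 1.
      by rewrite mulfV // gt_eqF // sqrtr_gt0.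
    by rewrite -[RHS]mul1r -[X in _ = X * _]h; lra.
  rewrite normrN normrM (ger0_norm g0) ler_wpM2l //.
  apply: (le_trans (ler_norm_sum _ _ _)); rewrite le_eqVlt; apply/orP; left; apply/eqP.
  by apply: eq_bigr => i _; rewrite normrM (ger0_norm (th0 i)).
set K := \sum_(i <- s) th i t `^ a; set D := \sum_(i <- s) `|d i| `^ q.
have K0 : 0 <= K by apply: sumr_ge0 => i _; exact: powR_ge0.
have D0 : 0 <= D by apply: sumr_ge0 => i _; exact: powR_ge0.
have H := @hoelder_seq I s (th ^~ t) (fun i => `|d i|) a q th0 (fun=> normr_ge0 _) a0 q0 aq.
have {}H := le_trans dGle (ler_wpM2l g0 H).
have S0 : 0 <= S t.
  by apply: sumr_ge0 => i _; rewrite mulr_ge0 // ln_ge0 // coshR_ge1.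
have KS : K <= b `^ (- crit_pow b) / crit_dist b * S t.
  by rewrite /K /S mulr_sumr; apply: ler_sum => i _; exact: powR_tanh_le.
(* With [m = crit_pow b] and [t0 = crit_dist b], the constants multiply to [b^-m / t0 * b^-m * (b *
   t0) = b^(1 - 2 m)], and [a = 2 m]. *)
have gK : g `^ a * K <= b `^ (1 - a).
  have ga : g `^ a = (F t / (1 + F t)) `^ crit_pow b.
    rewrite /a powRrM powR_mulrn // /g exprMn exprVn.
    by rewrite !sqr_sqrtr ?(ltW F1) ?(ltW (F0 t)).
  have h := powR_occupation_le _ _ _ b1 lam0 lamle S0.
  apply: le_trans (ler_wpM2l (powR_ge0 _ _) KS) _.
  rewrite ga mulrCA.
  have c0 : 0 <= b `^ (- crit_pow b) / crit_dist b.
    by rewrite divr_ge0 ?powR_ge0 // ltW.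
  apply: le_trans (ler_wpM2l c0 h) _.
  have -> : 1 - a = 1 + (- crit_pow b + - crit_pow b).
    by rewrite /a mulr_natl mulr2n opprD.
  rewrite !powRD ?(gt_eqF bp) ?implybT // powRr1 ?(ltW bp) //.
  have ht : crit_dist b * (crit_dist b)^-1 = 1 by rewrite mulfV ?gt_eqF.
  rewrite le_eqVlt; apply/orP; left; apply/eqP; rewrite -[RHS]mul1r -ht.
  by move: (b `^ _) (crit_dist b) => u z; clear; lra.
(* The [a]-th root turns the exponent [1 - a] into [- 1 / q]; the final power [q] then leaves
   [1 / b]. *)
have gK' : g * K `^ a^-1 <= b `^ (- q^-1).
  have : (g `^ a * K) `^ a^-1 <= (b `^ (1 - a)) `^ a^-1.
    rewrite ge0_ler_powR ?nnegrE ?invr_ge0 ?(ltW a0) ?powR_ge0 //.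
    by rewrite mulr_ge0 ?powR_ge0.
  rewrite powRM ?powR_ge0 // -!powRrM mulfV ?gt_eqF // powRr1 //.
  suff -> : (1 - a) * a^-1 = - q^-1 by [].
  by rewrite mulrBl mul1r mulfV ?gt_eqF // -[X in _ - X]aq opprD addrA subrr sub0r.
have {}H : `|dG t| <= b `^ (- q^-1) * D `^ q^-1.
  by apply: le_trans H _; rewrite mulrA ler_wpM2r ?powR_ge0.
have := ge0_ler_powR (ltW q0) _ _ H; rewrite !nnegrE normr_ge0 mulr_ge0 ?powR_ge0 //.
move=> /(_ isT isT); rewrite powRM ?powR_ge0 // -!powRrM mulNr !mulVf ?gt_eqF //.
by rewrite powRr1 // powR_inv1 // ltW.
Qed.

End Scalar.

Arguments crit_conj {R} b.
Arguments potential {R} x.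

(** * Rooted trees and cutsets *)

Section RootedTree.
Variable T : rootedTree.
Implicit Types (u v w c : T) (C : set T) (A : {fset T}).

Lemma iter_depth v : iter (depth v) parent v = root.
Proof. by rewrite /depth; case: ex_minnP => n /eqP. Qed.

Lemma depth_le n v : iter n parent v = root -> (depth v <= n)%N.
Proof. by rewrite /depth; case: ex_minnP => m _ mle /eqP; exact: mle. Qed.

Lemma depth_eq0 v : depth v = 0%N -> v = root.
Proof. by move=> d0; have := iter_depth v; rewrite d0. Qed.

Lemma depth_root : depth (root : T) = 0%N.
Proof. by apply/eqP; rewrite -leqn0 depth_le. Qed.

Lemma depth_parent v : depth (parent v) = (depth v).-1.
Proof.
case E : (depth v) => [|k].
  by rewrite (depth_eq0 _ E) parent_root depth_root.
apply/eqP; rewrite eqn_leq; apply/andP; split.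
  by apply: depth_le; rewrite -iterSr -E iter_depth.
by rewrite -ltnS -E; apply: depth_le; rewrite iterSr iter_depth.
Qed.

Lemma depth_iter n v : depth (iter n parent v) = (depth v - n)%N.
Proof. by elim: n => [|n IH] /=; rewrite ?subn0 // depth_parent IH subnS. Qed.

(** Reflexive ancestry as a boolean, usable as a filter in sums: if [v] is an iterated parent of
    [w], it is the one at the depth of [v]. *)
Definition below v w : bool := iter (depth w - depth v) parent w == v.

Lemma belowP v w : reflect (exists n, iter n parent w = v) (below v w).
Proof.
apply: (iffP eqP) => [<-|[n <-]]; first by exists (depth w - depth v)%N.
rewrite depth_iter; case: (leqP n (depth w)) => nw; first by rewrite subKn.
have -> : (depth w - n = 0)%N by apply/eqP; rewrite subn_eq0 ltnW.
rewrite subn0 iter_depth -(subnK (ltnW nw)) iterD iter_depth.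
by elim: (n - depth w)%N => //= k <-; rewrite parent_root.
Qed.

Lemma below_refl v : below v v.
Proof. by apply/belowP; exists 0%N. Qed.

Lemma below_depth v w : below v w -> (depth v <= depth w)%N.
Proof. by case/belowP => n <-; rewrite depth_iter leq_subr. Qed.

Lemma below_trans u v w : below u v -> below v w -> below u w.
Proof.
move=> /belowP[n <-] /belowP[m <-]; apply/belowP; exists (n + m)%N.
by rewrite iterD.
Qed.

Lemma below_root v : below root v.
Proof. by apply/belowP; exists (depth v); rewrite iter_depth. Qed.

(** [w <> v] keeps the root from being its own child. [fset_set] has the intended members only for
    finite sets, which local finiteness ensures. *)
Definition children v : {fset T} := fset_set [set w | parent w = v /\ w <> v].

Hypothesis locfin : locally_finite T.

Lemma childrenP v w : reflect (parent w = v /\ w <> v) (w \in children v).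
Proof.
rewrite in_fset_set; first by apply: (iffP idP) => [/set_mem //|]; exact: mem_set.
apply: sub_finite_set (locfin v) => {}w [pw wv].
by rewrite /= /adj pw eqxx orbT andbT eq_sym; apply/eqP.
Qed.

Lemma depth_child v c : c \in children v -> depth c = (depth v).+1.
Proof.
case/childrenP => pc cv; have := depth_parent c; rewrite pc => ->.
case E : (depth c) => //; case: cv.
by have cr := depth_eq0 _ E; rewrite -pc cr parent_root.
Qed.

Lemma below_child v c : c \in children v -> below v c.
Proof. by case/childrenP => pc _; apply/belowP; exists 1%N. Qed.

Lemma adj_child v c : c \in children v -> adj v c.
Proof.
by case/childrenP => pc cv; rewrite /adj pc eqxx orbT andbT eq_sym; apply/eqP.
Qed.

Lemma adj_cases v w : adj v w -> w = parent v \/ w \in children v.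
Proof.
case/andP => /eqP vw /orP[/eqP <-|/eqP pw]; first by left.
by right; apply/childrenP; split => // e; apply: vw.
Qed.

Lemma below_cases v w : below v w -> w <> v ->
  exists2 c, c \in children v & below c w.
Proof.
move=> /belowP[n]; elim: n => [/= -> //|n IH /= e wv].
have [uv|/eqP uv] := eqVneq (iter n parent w) v; first exact: IH.
by exists (iter n parent w); [apply/childrenP | apply/belowP; exists n].
Qed.

Lemma below_child_uniq v c c' w : c \in children v -> c' \in children v ->
  below c w -> below c' w -> c = c'.
Proof.
move=> /depth_child cd /depth_child c'd /eqP + /eqP.
by rewrite cd c'd => -> ->.
Qed.

(** Subtrees below distinct children are disjoint and lie below [v], so each [w] is counted at most
    once. *)
Lemma sum_below_children (R : numDomainType) (f : T -> R) (W : {fset T}) v :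
  (forall w, 0 <= f w) ->
  \sum_(c <- children v) \sum_(w <- W | below c w) f w <=
    \sum_(w <- W | below v w) f w.
Proof.
move=> f0; under eq_bigr do rewrite big_mkcond.
rewrite exchange_big [leRHS]big_mkcond /=; apply: ler_sum => w _.
case: (pselect (exists2 c, c \in children v & below c w)) => [[c cv cw]|nc].
  rewrite (big_fsetD1 c) //= cw (below_trans _ _ _ (below_child _ _ cv) cw).
  rewrite big_seq big1 ?addr0 // => c'; rewrite !inE => /andP[/eqP c'c c'v].
  by case: ifP => // c'w; case: c'c; exact: below_child_uniq c'v cv c'w cw.
rewrite big_seq big1 => [|c cv]; first by case: ifP.
by case: ifP => // cw; case: nc; exists c.
Qed.

(** * Cutsets and finiteness of the tree above them *)

Lemma uptoP C v : upto C v <-> forall u, C u -> below u v -> u = v.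
Proof.
split => [Cv u Cu uv|Cv u Cu [uv /belowP uv']]; last exact/uv/Cv.
have [//|/eqP uv'] := eqVneq u v.
by case: (Cv u Cu); split => //; exact/belowP.
Qed.

Lemma cutset_upto C : cutset C -> C `<=` upto C.
Proof. by move=> [_ anti] v Cv u Cu; exact: anti. Qed.

Lemma upto_child C v c : upto C v -> ~ C v -> c \in children v -> upto C c.
Proof.
move=> /uptoP Cv nCv cv; apply/uptoP => u Cu /belowP[[//|n]].
have [pc _] := childrenP _ _ cv.
rewrite iterSr pc => nu; case: nCv.
by rewrite -(Cv u Cu) //; apply/belowP; exists n.
Qed.

(* Koenig's lemma: otherwise vertices with infinitely many descendants in [upto C]
   form an infinite path avoiding [C]. *)
Lemma upto_finite C : cutset C -> finite_set (upto C).
Proof.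
move=> [Cpath _]; apply: contrapT => Cinf.
pose D v := [set w | upto C w /\ below v w].
have step v : ~ finite_set (D v) ->
    ~ C v /\ exists c, c \in children v /\ ~ finite_set (D c).
  move=> Dv; have nCv : ~ C v.
    move=> Cv; apply: Dv; apply: sub_finite_set (finite_set1 v) => w [/uptoP Cw vw].
    by rewrite /= (Cw v).
  split => //; apply: contrapT => nc; apply: Dv.
  have Dc : finite_set (\bigcup_(c in [set` children v]) D c).
    apply: bigcup_finite => // c /= cv.
    by apply: contrapT => Dc; apply: nc; exists c.
  have : finite_set ([set v] `|` \bigcup_(c in [set` children v]) D c).
    by rewrite finite_setU; split => //; exact: finite_set1.
  apply: sub_finite_set => w [Cw vw].
  have [->|/eqP wv] := eqVneq w v; [by left|right].
  by have [c cv cw] := below_cases _ _ vw wv; exists c.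
(* Bundling infinitude with the vertex gives every element of [X] a successor, as dependent choice
   requires. *)
pose X := {v | ~ finite_set (D v)}.
have Dr : ~ finite_set (D root).
  apply: contra_not Cinf; apply: sub_finite_set => v Cv; split => //.
  exact: below_root.
pose next (x y : X) := ~ C (sval x) /\ sval y \in children (sval x).
have [x|p [p0 pS]] := @dependent_choice X next _ (exist _ root Dr).
  apply: cid; have [nC [c [cx Dc]]] := step _ (svalP x).
  by exists (exist _ c Dc).
pose g n := sval (p n).
have gd n : depth (g n) = n.
  elim: n => [|n IH]; first by rewrite /g p0 /= depth_root.
  by rewrite (depth_child _ _ (pS n).2) -/(g n) IH.
have [|n Cn] := Cpath g; last by case: (pS n).
split => [|m n mn|n]; first by rewrite /g p0.
  by rewrite -(gd m) mn gd.
exact: adj_child (pS n).2.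
Qed.

End RootedTree.

Arguments below {T} v w.
Arguments children {T} v.

(** * The tree recursion *)

Section PartitionFunction.
Variables (R : realType) (T : rootedTree) (lam : R) (C sigma : set T).
Hypotheses (locfin : locally_finite T) (sigmaC : sigma `<=` C).
Implicit Types (u v w c : T) (A : {fset T}) (I J : {fset T}).

(* The configuration has to agree with [sigma] on all of [C], not only on [A]; so
   [partition_fun A = 0] as soon as [A] misses a vertex of [sigma]. *)
Definition configs A : set {fset T} :=
  [set I | [/\ [set` I] `<=` [set` A], independent [set` I] & agrees C sigma I]].

Definition partition_fun A : R := \sum_(I \in configs A) lam ^+ #|` I|.

Lemma finite_fsubsets A (P : set {fset T}) :
  (forall I, P I -> [set` I] `<=` [set` A]) -> finite_set P.
Proof.
move=> PA; apply: (@finite_subfset _ (fpowerset A)) => I /PA IA /=.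
by rewrite fpowersetE; apply/fsubsetP => x; exact: IA.
Qed.

Lemma finite_configs A : finite_set (configs A).
Proof. by apply: (finite_fsubsets A) => I []. Qed.

Lemma partition_fun_split A v :
  partition_fun A =
    \sum_(I \in configs A `&` [set I : {fset T} | v \in I]) lam ^+ #|` I| +
    partition_fun (A `\ v)%fset.
Proof.
rewrite {1}/partition_fun (fsbigID [set I : {fset T} | v \in I]) //=; last exact: finite_configs.
congr (_ + _); apply: eq_fsbigl; apply/seteqP; split => I /=.
  move=> [[IA ind agr] vI]; split => // x xI; rewrite /= !inE; apply/andP; split.
    by apply/eqP => xv; apply: vI; rewrite -xv.
  exact: IA.
move=> [IA ind agr]; split; first by split => // x /IA; rewrite /= !inE => /andP[].
by move=> /IA; rewrite /= !inE eqxx.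
Qed.

(** Deleting [v] is a bijection onto the configurations avoiding [v] and its neighbours, and divides
    the weight by [lam]; agreement on [C] is unaffected because [v] is outside [C]. *)
Lemma partition_fun_occupied A v N : v \in A -> ~ C v ->
    (forall w, w \in A -> adj v w -> w \in N) ->
    (forall w, w \in N -> adj v w) ->
  \sum_(I \in configs A `&` [set I : {fset T} | v \in I]) lam ^+ #|` I| =
    lam * partition_fun ((A `\ v) `\` N)%fset.
Proof.
move=> vA nCv AN Nv; rewrite mulr_fsumr.
have nv (J : {fset T}) : configs ((A `\ v) `\` N)%fset J -> v \notin J.
  by move=> [JA _ _]; apply/negP => /JA; rewrite /= !inE eqxx /= andbF.
rewrite (reindex_fsbig (fun J => v |` J)%fset (configs ((A `\ v) `\` N)%fset)).
  apply: eq_fsbigr => J /set_mem /nv vJ.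
  by rewrite cardfsU1 vJ exprS.
have adjC x y : adj x y = adj y x by rewrite /adj eq_sym orbC.
split.
- move=> J cJ; have vJ := nv _ cJ; case: cJ => JA ind agr; split => /=; last first.
    by rewrite !inE eqxx.
  split.
  + move=> x /=; rewrite !inE => /orP[/eqP -> //|/JA]; rewrite /= !inE.
    by case/andP => _ /andP[].
  + have vx x : x \in J -> ~~ adj v x.
      move=> /JA; rewrite /= !inE => /andP[xN /andP[_ xA]].
      by apply/negP => /(AN _ xA) xN'; rewrite xN' in xN.
    move=> x y /=; rewrite !inE => /orP[/eqP ->|xJ] /orP[/eqP ->|yJ].
    * by rewrite /adj eqxx.
    * exact: vx.
    * by rewrite adjC; exact: vx.
    * exact: ind.
  + rewrite /agrees /= -agr; apply/seteqP; split => x /= [].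
      by rewrite !inE => /orP[/eqP -> //|].
    by move=> xJ Cx; rewrite !inE xJ orbT.
- move=> J K /set_mem /nv vJ /set_mem /nv vK /= e.
  apply/fsetP => x; have /fsetP/(_ x) := e; rewrite !inE.
  by have [->|//] := eqVneq x v; rewrite (negbTE vJ) (negbTE vK).
- move=> I [[IA ind agr] /= vI]; exists (I `\ v)%fset; last first.
    by rewrite fsetD1K.
  split.
  + move=> x /=; rewrite !inE => /andP[xv xI]; rewrite xv (IA _ xI) /= andbT.
    by apply/negP => /Nv; apply/negP; exact: ind.
  + by move=> x y /=; rewrite !inE => /andP[_ xI] /andP[_ yI]; exact: ind.
  + rewrite /agrees /= -agr; apply/seteqP; split => x /= [].
      by rewrite !inE => /andP[].
    move=> xI Cx; split => //; rewrite !inE xI andbT.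
    by apply/eqP => xv; apply: nCv; rewrite -xv.
Qed.

Lemma partition_fun_vacant A v : C v -> ~ sigma v ->
  partition_fun (A `\ v)%fset = partition_fun A.
Proof.
move=> Cv nsv; rewrite (partition_fun_split A v) [X in _ = X + _]fsbig1 ?add0r //.
move=> I [[_ _ agr] /= vI]; case: nsv.
by rewrite -agr.
Qed.

Lemma partition_fun_missing A v : sigma v -> partition_fun (A `\ v)%fset = 0.
Proof.
move=> sv; apply: fsbig1 => I [IA _ agr].
have : ([set` I] `&` C) v by rewrite agr.
by case=> /IA; rewrite /= !inE eqxx.
Qed.

(* The probability that [v] is vacant in the subtree below [v], computed down to
   [n] generations below [v]. *)
Fixpoint vacancy (n : nat) v : R :=
  if n is n'.+1 then
    if `[< C v >] then (~~ `[< sigma v >])%:R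
    else (1 + lam * \prod_(c <- children v) vacancy n' c)^-1
  else 1.

(** The occupation ratio at [v] when [v] is outside [C]. On [C] a ratio could be infinite, so the
    recursion runs through vacancies. *)
Definition message n v : R := lam * \prod_(c <- children v) vacancy n c.

Hypothesis lam_gt0 : 0 < lam.

Lemma vacancy_itv n v : 0 <= vacancy n v <= 1.
Proof.
elim: n v => [|n IH] v /=; first by rewrite ler01 lexx.
case: ifP => _; first by case: (~~ _); rewrite ?ler01 ?lexx.
have h : 0 <= lam * \prod_(c <- children v) vacancy n c.
  rewrite mulr_ge0 ?(ltW lam_gt0) // prodr_ge0 // => c _.
  by case/andP: (IH c).
by rewrite invr_ge0 invf_le1; lra.
Qed.

Lemma message_itv n v : 0 <= message n v <= lam.
Proof.
have h : 0 <= \prod_(c <- children v) vacancy n c <= 1.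
  elim/big_rec: _ => [|c x _ /andP[x0 x1]]; first by rewrite ler01 lexx.
  have /andP[c0 c1] := vacancy_itv n c.
  by rewrite mulr_ge0 // mulr_ile1.
rewrite /message; move: h => /andP[h1 h2]; apply/andP; split.
  by rewrite mulr_ge0 // ltW.
by rewrite ger_pMr.
Qed.

Lemma vacancy_message n v : ~ C v -> vacancy n.+1 v = (1 + message n v)^-1.
Proof. by move=> nCv; rewrite /= asboolF. Qed.

(* Deleting the children of [v] one after the other multiplies the partition
   function by their vacancies, so no factorization over subtrees is needed. *)
Lemma partition_fun_remove N n v A : (N <= depth v + n)%N ->
    (forall w, upto C w -> (depth w < N)%N) ->
    upto C v -> v \in A ->
    (forall w, w \in A -> adj v w -> w \in children v) ->
    (forall w, upto C w -> below v w -> w \in A) ->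
  partition_fun (A `\ v)%fset = vacancy n v * partition_fun A.
Proof.
move=> + ltN; elim: n v A => [|n IH] v A Nv Cv vA Aadj Abelow.
  (* With no generation left, [N <= depth v] contradicts the depth bound on [upto C]. *)
  by have := ltN _ Cv; rewrite ltnNge -[depth v]addn0 Nv.
have [Cv'|nCv] := pselect (C v).
  rewrite /= asboolT //; have [sv|nsv] := pselect (sigma v).
    by rewrite asboolT // mul0r partition_fun_missing.
  by rewrite asboolF // mul1r partition_fun_vacant.
have tele (s : seq T) : uniq s -> {subset s <= children v} ->
    partition_fun ((A `\ v) `\` [fset x in s])%fset =
    \prod_(c <- s) vacancy n c * partition_fun (A `\ v)%fset.
  elim: s => [_ _|c s IHs /= /andP[cs us] sv].
    rewrite big_nil mul1r; congr partition_fun; apply/fsetP => x.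
    by rewrite !inE.
  have cv : c \in children v by apply: sv; rewrite mem_head.
  have sv' : {subset s <= children v} by move=> x xs; apply: sv; rewrite inE xs orbT.
  rewrite big_cons -mulrA -IHs //.
  have -> : ((A `\ v) `\` [fset x in c :: s] = ((A `\ v) `\` [fset x in s]) `\ c)%fset.
    by apply/fsetP => x; rewrite !inE negb_or -andbA.
  have cd := depth_child _ locfin _ _ cv.
  have cdesc w : below c w -> w != v /\ w \notin s.
    move=> cw; have := below_depth _ _ _ cw; rewrite cd => vw; split.
      by apply: contraTneq vw => ->; rewrite ltnn.
    apply/negP => ws; have wv := sv' _ ws.
    have e := below_child_uniq _ locfin _ _ _ _ cv wv cw (below_refl _ _).
    by rewrite e ws in cs.
  have Cc := upto_child _ locfin _ _ _ Cv nCv cv.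
  have inB w : upto C w -> below c w -> w \in ((A `\ v) `\` [fset x in s])%fset.
    move=> Cw cw; have [wv ws] := cdesc _ cw; rewrite !inE wv ws /=.
    by apply: Abelow => //; exact: below_trans (below_child _ locfin _ _ cv) cw.
  apply: IH => //.
  - by rewrite cd addSnnS.
  - by apply: inB => //; exact: below_refl.
  (* [v] is already deleted, so the remaining neighbours of [c] are its children. *)
  - move=> w; rewrite !inE => /andP[_ /andP[wv _]].
    move=> /(adj_cases _ locfin)[wE|//].
    by case/childrenP: cv => // pc _; rewrite wE pc eqxx in wv.
have {}tele : partition_fun ((A `\ v) `\` children v)%fset =
    \prod_(c <- children v) vacancy n c * partition_fun (A `\ v)%fset.
  rewrite -tele ?fset_uniq //; congr partition_fun.
  by apply/fsetP => x; rewrite !inE.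
(* Splitting on the state of [v] shows that [partition_fun A] is [1 + message n v] times
   [partition_fun] of [A] without [v]. *)
have := partition_fun_split A v; rewrite (partition_fun_occupied _ _ (children v)) //.
  rewrite tele vacancy_message // => ->.
  have := message_itv n v; rewrite /message; set m := lam * _ => mI.
  have m1 : 1 + m != 0 by rewrite gt_eqF //; lra.
  have -> : lam * (\prod_(c <- children v) vacancy n c * partition_fun (A `\ v)%fset) +
     partition_fun (A `\ v)%fset = (1 + m) * partition_fun (A `\ v)%fset.
    by rewrite mulrA -/m mulrDl mul1r addrC.
  by rewrite mulrA mulVf // mul1r.
by move=> w; exact: adj_child.
Qed.

Hypothesis Ccut : cutset C.
Hypothesis sigma_ind : independent sigma.

(** One admissible set has positive weight and the sum is finite by [upto_finite]; this keeps the
    normalizing constants nonzero. *)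
Lemma hc_weight_gt0 (E : set {fset T}) I : independent_sets C I -> E I ->
  0 < hc_weight lam C E.
Proof.
move=> indI EI; have fin : finite_set (independent_sets C `&` E).
  apply: (finite_fsubsets (fset_set (upto C))) => J [[JC _] _].
  by rewrite fset_setK //; exact: upto_finite.
have ge0 J : (independent_sets C `&` E) J -> 0 <= lam ^+ #|` J|.
  by rewrite exprn_ge0 // ltW.
rewrite lt_neqAle fsumr_ge0 // andbT eq_sym; apply/eqP => e.
have := pfsumr_eq0 fin ge0 e (conj indI EI).
by apply/eqP; rewrite expf_neq0 // gt_eqF.
Qed.

(** Deleting the root from all of [upto C] gives its vacancy [1 - p = (1 + message n root)^-1],
    whence [p / (1 - p)] is the message. *)
Lemma root_ratio_message n : ~ C root -> (forall w, upto C w -> (depth w <= n)%N) ->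
  root_ratio lam C sigma = (message n root)%:E.
Proof.
move=> nCr len; pose U := fset_set (upto C).
have Ufin := upto_finite _ locfin _ Ccut.
have UE : [set` U] = upto C by exact: fset_setK.
have inU w : upto C w -> w \in U by move=> Cw; have : [set` U] w by rewrite UE.
have Ur : upto C root.
  apply/uptoP => u Cu /below_depth; rewrite depth_root leqn0 => /eqP.
  exact: depth_eq0.
have W1 : hc_weight lam C (agrees C sigma) = partition_fun U.
  apply: eq_fsbigl; apply/seteqP; split => I /=.
    by move=> [[IC ind] agr]; split => //; rewrite UE.
  by move=> [IU ind agr]; split => //; split => //; rewrite -UE.
have W2 : hc_weight lam C ([set I : {fset T} | root \in I] `&` agrees C sigma) =
    partition_fun U - partition_fun (U `\ root)%fset.
  rewrite (partition_fun_split U root) addrK.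
  apply: eq_fsbigl; apply/seteqP; split => I /=.
    by move=> [[IC ind] [rI agr]]; split => //; split => //; rewrite UE.
  by move=> [[IU ind agr] rI]; split => //; split => //; rewrite -UE.
have W3 : partition_fun (U `\ root)%fset = vacancy n.+1 root * partition_fun U.
  apply: (@partition_fun_remove n.+1) => //.
  - by rewrite depth_root add0n.
  - exact: inU.
  - move=> w _ rw; case: (adj_cases _ locfin _ _ rw) => // wr.
    by move: rw; rewrite wr parent_root /adj eqxx.
  - by move=> w Cw _; exact: inU.
(* [sigma] itself is a configuration. *)
have W0 : 0 < partition_fun U.
  rewrite -W1; have sfin : finite_set sigma.
    apply: sub_finite_set Ufin => v /sigmaC; exact: cutset_upto.
  apply: (hc_weight_gt0 _ (fset_set sigma)).
    rewrite /independent_sets /= fset_setK //; split => // v /sigmaC.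
    exact: cutset_upto.
  rewrite /agrees /= fset_setK //; apply/seteqP; split => v; first by case.
  by move=> sv; split => //; exact: sigmaC.
have WT : 0 < hc_weight lam C setT.
  apply: (hc_weight_gt0 _ fset0) => //; split => [v|u v]; by rewrite /= inE.
have mI := message_itv n root.
have m1 : 1 + message n root != 0 by rewrite gt_eqF //; lra.
have pE : root_prob lam C sigma = 1 - (1 + message n root)^-1.
  rewrite /root_prob /hc_cond_prob /hc_prob W2 W1 W3 vacancy_message //.
  have e' : partition_fun U / partition_fun U = 1 by rewrite mulfV ?gt_eqF.
  by rewrite invf_div mulrA divfK ?gt_eqF // mulrBl e' -mulrA e' mulr1.
rewrite /root_ratio pE inver.
have -> : 1 - (1 - (1 + message n root)^-1) = (1 + message n root)^-1 by lra.
rewrite invr_eq0 (negbTE m1) invrK -EFinM mulrBl mulVf //; congr EFin; lra.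
Qed.

End PartitionFunction.

(** * Decay of correlations and uniqueness *)

Section Uniqueness.
Variables (R : realType) (T : rootedTree).
Hypothesis locfin : locally_finite T.
Implicit Types (b lam : R) (C sigma tau : set T).

Lemma lambda_c_lt_right b lam : 1 < b -> lam < lambda_c b ->
  exists2 b', b < b' & lam < lambda_c b'.
Proof.
move=> b1; rewrite lambda_cE // => lamlt.
have b0 : 0 < b - 1 by rewrite subr_gt0.
have c1 : x - 1 @[x --> b] --> b - 1 by apply: cvgB; [exact: cvg_id|exact: cvg_cst].
have c2 : (x - 1)^-1 @[x --> b] --> (b - 1)^-1 by apply: cvgV => //; rewrite gt_eqF.
have c3 : x / (x - 1) @[x --> b] --> b / (b - 1) by apply: cvgM => //; exact: cvg_id.
have c4 : crit_dist R x @[x --> b] --> crit_dist R b.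
  by apply: (continuous_cvg _ (continuous_ln _) c3); rewrite divr_gt0 //; lra.
have c5 : x * crit_dist R x @[x --> b] --> b * crit_dist R b.
  by apply: cvgM => //; exact: cvg_id.
have c6 : expR (x * crit_dist R x) @[x --> b] --> expR (b * crit_dist R b).
  exact: (continuous_cvg _ (@continuous_expR R _) c5).
have c7 : expR (x * crit_dist R x) / (x - 1) @[x --> b] -->
    expR (b * crit_dist R b) / (b - 1) by exact: cvgM.
(* The strict inequality persists near [b] by continuity, and right neighbourhoods of [b] are
   nonempty. *)
have nr : \forall x \near b^'+, b < x /\ lam < expR (x * crit_dist R x) / (x - 1).
  near=> x; split; first by near: x; exact: nbhs_right_gt.
  near: x; apply: (@cvgr_gt _ _ b^'+ _ (fun x => expR (x * crit_dist R x) / (x - 1)) _ _ _ lamlt).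
  exact: cvg_at_right_filter c7.
have [x [bx lamx]] := filter_ex nr.
by exists x => //; rewrite lambda_cE //; lra.
Unshelve. all: by end_near. Qed.

(** The branching factor supplies some [beta < b'] whose cutset sums have infimum 0, and
    [b'^-n <= beta^-n]. *)
Lemma cutset_small_sum b b' (e : R) : branching_factor R T = b%:E ->
    b < b' -> 0 < e ->
  exists2 C : set T, cutset C & (\esum_(v in C) (b' ^- depth v)%:E < e%:E)%E.
Proof.
move=> br bb' e0.
have [|_ [beta [beta0 inf0] <-]] :=
  @ereal_inf_lt R _ b'%:E (_ : (branching_factor R T < b'%:E)%E).
  by rewrite br lte_fin.
rewrite lte_fin => betab'.
have [|_ [C Ccut <-] Ce] := @ereal_inf_lt R _ e%:E (_ : (ereal_inf
  [set \esum_(v in C) (beta ^- depth v)%:E | C in @cutset T] < e%:E)%E).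
  by rewrite inf0 lte_fin.
exists C => //; apply: le_lt_trans Ce; apply: le_esum => v _.
have b'0 : 0 < b' by exact: lt_trans betab'.
rewrite lee_fin lef_pV2 ?posrE ?exprn_gt0 //.
by rewrite lerXn2r ?nnegrE // ltW.
Qed.

(* A vertex with a child in [C] is covered by the trivial bound [potential lam]: the
   contraction cannot start on [C] itself, where the ratio may be infinite. *)
Lemma message_discrepancy b lam C sigma tau n v :
    1 < b -> 0 < lam -> lam <= lambda_c b -> finite_set C -> ~ C v ->
  `|potential (message R T lam C sigma n v) -
    potential (message R T lam C tau n v)| `^ crit_conj b * b ^- depth v <=
  potential lam `^ crit_conj b * b *
    \sum_(w <- fset_set C | below v w) b ^- depth w.
Proof.
move=> b1 lam0 lamle Cfin.
have bp : 0 < b by lra.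
have q0 := crit_conj_gt0 _ _ b1.
have M0 : 0 <= potential lam `^ crit_conj b * b by rewrite mulr_ge0 ?powR_ge0 // ltW.
have bV k : 0 <= b ^- k by rewrite invr_ge0 exprn_ge0 // ltW.
elim: n v => [|n IH] v nCv.
  (* At [n = 0] neither message sees its boundary condition, so they coincide. *)
  rewrite /message /= subrr normr0 powR0 ?gt_eqF // mul0r mulr_ge0 //.
  exact: sumr_ge0.
have [[c cv Cc]|nc] := pselect (exists2 c, c \in children v & C c).
  have cW : c \in fset_set C by rewrite in_fset_set // inE.
  (* The factor [b] in the constant pays for the generation between [v] and [c]. *)
  apply: (@le_trans _ _ (potential lam `^ crit_conj b * b * b ^- depth c)).
    rewrite (depth_child _ locfin _ _ cv) exprS invfM mulrA.
    rewrite -(mulrA _ b) mulfV ?gt_eqF // mulr1 ler_wpM2r //.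
    have /andP[x0 x1] := message_itv R T lam C sigma lam0 n.+1 v.
    have /andP[y0 y1] := message_itv R T lam C tau lam0 n.+1 v.
    apply: ge0_ler_powR; rewrite ?nnegrE ?(ltW q0) ?potential_ge0 ?(ltW lam0) //.
    have := potential_ge0 _ _ x0; have := potential_ge0 _ _ y0.
    have := le_potential _ _ _ x0 x1; have := le_potential _ _ _ y0 y1.
    by rewrite ler_norml; lra.
  rewrite ler_wpM2l // (big_mkcond (below v)) (big_fsetD1 c) //=.
  rewrite (below_child _ locfin _ _ cv) lerDl sumr_ge0 // => w _.
  by case: ifP.
have mE s : message R T lam C s n.+1 v =
    lam * \prod_(c <- children v) (1 + message R T lam C s n c)^-1.
  congr (_ * _); apply: eq_big_seq => c cv.
  by rewrite vacancy_message // => Cc; apply: nc; exists c.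
rewrite !mE.
have H := hard_core_contraction R b lam T (children v)
  (message R T lam C sigma n) (message R T lam C tau n) b1 lam0 lamle
  (fun c => (andP (message_itv R T lam C sigma lam0 n c)).1)
  (fun c => (andP (message_itv R T lam C tau lam0 n c)).1).
apply: le_trans (ler_wpM2r (bV _) H) _.
(* The contraction factor [b^-1] turns the weight at [v] into the weight at its children. *)
rewrite mulrAC -invfM -exprS mulr_sumr.
apply: (@le_trans _ _ (\sum_(c <- children v) potential lam `^ crit_conj b * b *
    \sum_(w <- fset_set C | below c w) b ^- depth w)).
  rewrite big_seq [leRHS]big_seq; apply: ler_sum => c cv.
  rewrite mulrC -(depth_child _ locfin _ _ cv); apply: IH => Cc.
  by apply: nc; exists c.
by rewrite -mulr_sumr ler_wpM2l // sum_below_children.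
Qed.

Definition lip_const lam : R := 2 * Num.sqrt lam * expR (potential lam).

Lemma discrepancy_itv b lam C :
    1 < b -> 0 < lam -> lam <= lambda_c b -> cutset C -> ~ C root ->
  (0 <= discrepancy lam C <=
    (lip_const lam * (potential lam `^ crit_conj b * b *
      \sum_(w <- fset_set C) b ^- depth w) `^ (crit_conj b)^-1)%:E)%E.
Proof.
move=> b1 lam0 lamle Ccut nCr.
have q0 := crit_conj_gt0 _ _ b1.
have qV : 0 <= (crit_conj b)^-1 by rewrite invr_ge0 ltW.
have Ufin := upto_finite _ locfin _ Ccut.
have Cfin : finite_set C by apply: sub_finite_set Ufin; exact: cutset_upto.
(* A depth bound for the finite set [upto C], so [message n root] is the exact ratio for every
   boundary condition. *)
pose n := (\max_(w <- fset_set (upto C)) depth w)%N.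
have len w : upto C w -> (depth w <= n)%N.
  by move=> Cw; apply: leq_bigmax_seq => //; rewrite in_fset_set // inE.
have ratioE sigma : boundary_condition C sigma ->
    root_ratio lam C sigma = (message R T lam C sigma n root)%:E.
  by move=> [sC ind]; exact: root_ratio_message.
apply/andP; split.
  (* Two equal boundary conditions give 0, and the empty one is always available. *)
  apply: ereal_sup_ubound; exists set0, set0.
  have bc0 : boundary_condition C set0 by split => // u v [].
  by split => //; rewrite ratioE // -EFinB subrr.
apply: ge_ereal_sup => _ [sigma [tau [bs bt ->]]].
rewrite !ratioE // -EFinB lee_fin.
have /andP[x0 x1] := message_itv R T lam C sigma lam0 n root.
have /andP[y0 y1] := message_itv R T lam C tau lam0 n root.
apply: le_trans (sub_le_potential _ _ _ _ x0 y0 x1 y1) _.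
rewrite ler_wpM2l //.
have := message_discrepancy b lam C sigma tau n root b1 lam0 lamle Cfin nCr.
rewrite depth_root expr0 invr1 mulr1.
have -> : \sum_(w <- fset_set C | below root w) b ^- depth w =
    \sum_(w <- fset_set C) b ^- depth w.
  by apply: eq_bigl => w; exact: below_root.
set X := _ * _; set d := `|_| => dX.
have d0 : 0 <= d by exact: normr_ge0.
have : (d `^ crit_conj b) `^ (crit_conj b)^-1 <= X `^ (crit_conj b)^-1.
  apply: ge0_ler_powR; rewrite ?nnegrE ?qV ?powR_ge0 //.
  exact: le_trans (powR_ge0 _ _) dX.
by rewrite -powRrM mulfV ?gt_eqF // powRr1.
Qed.

Lemma cutset_small_discrepancy b b' lam (k : nat) :
    branching_factor R T = b%:E -> 1 < b' -> b < b' ->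
    0 < lam -> lam <= lambda_c b' ->
  exists C : set T, [/\ cutset C, forall v, C v -> (k <= depth v)%N &
    (0 <= discrepancy lam C <= (k.+1%:R^-1)%:E)%E].
Proof.
move=> br b'1 bb' lam0 lamle.
have b'0 : 0 < b' by lra.
have q0 := crit_conj_gt0 _ _ b'1.
have qV : 0 <= (crit_conj b')^-1 by rewrite invr_ge0 ltW.
have K0 : 0 <= lip_const lam by rewrite mulr_ge0 ?expR_ge0 // mulr_ge0 ?sqrtr_ge0.
set M := potential lam `^ crit_conj b' * b'.
have M0 : 0 <= M by rewrite mulr_ge0 ?powR_ge0 // ltW.
pose d : R := k.+1%:R^-1 / (lip_const lam + 1).
have k0 : 0 < k.+1%:R^-1 :> R by rewrite invr_gt0.
have d0 : 0 < d by rewrite divr_gt0 //; lra.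
(* The first bound forces [C] below depth [k], since one vertex at depth at most [k] already
   contributes [b'^-k]; the second makes the potential difference at most [d]. Adding 1 keeps the
   denominators positive. *)
pose e := Num.min (b' ^- k) (d `^ crit_conj b' / (M + 1)).
have e0 : 0 < e.
  rewrite lt_min invr_gt0 exprn_gt0 //= divr_gt0 ?powR_gt0 //; lra.
have [C Ccut Ce] := cutset_small_sum _ _ _ br bb' e0.
have Ufin := upto_finite _ locfin _ Ccut.
have Cfin : finite_set C by apply: sub_finite_set Ufin; exact: cutset_upto.
have bV m : 0 <= b' ^- m by rewrite invr_ge0 exprn_ge0 // ltW.
have sumE : (\esum_(v in C) (b' ^- depth v)%:E =
    (\sum_(w <- fset_set C) b' ^- depth w)%:E)%E.
  rewrite esum_fset //; first by rewrite fsbig_finite // sumEFin.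
  by move=> v _; rewrite lee_fin.
rewrite sumE lte_fin in Ce.
have deep v : C v -> (k < depth v)%N.
  move=> Cv; have vW : v \in fset_set C by rewrite in_fset_set // inE.
  have : b' ^- depth v < b' ^- k.
    apply: (@le_lt_trans _ _ (\sum_(w <- fset_set C) b' ^- depth w)).
      by rewrite (big_fsetD1 v) //= lerDl sumr_ge0.
    by apply: lt_le_trans Ce _; rewrite ge_min lexx.
  rewrite ltf_pV2 ?posrE ?exprn_gt0 // ltr_eXn2l //.
exists C; split => // [v /deep /ltnW //|].
(* Strictness in [deep] excludes the root even for [k = 0]. *)
have nCr : ~ C root by move/deep; rewrite depth_root.
have /andP[D0 D1] := discrepancy_itv _ _ _ b'1 lam0 lamle Ccut nCr.
rewrite D0 /=; apply: le_trans D1 _; rewrite lee_fin -/M.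
set s := \sum_(_ <- _) _ in Ce *.
have s0 : 0 <= s by exact: sumr_ge0.
have sle : s <= d `^ crit_conj b' / (M + 1).
  by apply: le_trans (ltW Ce) _; rewrite ge_min lexx orbT.
have Ms : M * s <= d `^ crit_conj b'.
  rewrite ler_pdivlMr in sle; last by lra.
  by apply: le_trans sle; rewrite mulrC ler_wpM2l //; lra.
have : (M * s) `^ (crit_conj b')^-1 <= d.
  have -> : d = (d `^ crit_conj b') `^ (crit_conj b')^-1.
    by rewrite -powRrM mulfV ?gt_eqF // powRr1 // ltW.
  apply: ge0_ler_powR; rewrite ?nnegrE ?qV ?powR_ge0 //.
  by rewrite mulr_ge0.
move=> /(ler_wpM2l K0) H; apply: le_trans H _.
rewrite /d mulrCA ger_pMr // ler_pdivrMr; lra.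
Qed.

End Uniqueness.

Theorem theorem6p1 (R : realType) (T : rootedTree) (b lam : R)
  (T_infinite : infinite_set [set: T])
  (T_locfin : locally_finite T)
  (T_br : branching_factor R T = b%:E)
  (b_gt1 : 1 < b)
  (lam_gt0 : 0 < lam)
  (lam_lt : lam < lambda_c b) :
  gibbs_uniqueness T lam.
Proof.
have [b' bb' lamb'] := lambda_c_lt_right _ _ _ b_gt1 lam_lt.
have b'1 : 1 < b' by lra.
(* The [k]-th cutset has distance at least [k] and discrepancy between 0 and [1 / (k + 1)], which
   gives both limits. *)
have [B BP] := choice (fun k => cutset_small_discrepancy _ _ T_locfin _ _ _ k
  T_br b'1 bb' lam_gt0 (ltW lamb')).
exists B; split.
- by move=> i; case: (BP i).
- apply/cvgeyPge => A; near=> i.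
  have [_ Bdeep _] := BP i.
  apply: le_ereal_inf_tmp => _ [v Bv <-]; rewrite lee_fin.
  apply: (@le_trans _ _ i%:R); last by rewrite ler_nat Bdeep.
  by near: i; exact: nbhs_infty_ger.
- apply: (@squeeze_cvge _ _ _ _ (fun=> 0%E) _ (fun i => ((i.+1)%:R^-1)%:E)).
  + by near=> i; case: (BP i).
  + exact: cvg_cst.
  + apply: cvg_EFin; first by near=> i.
    exact: cvg_harmonic.
Unshelve. all: by end_near. Qed.
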